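(* Let $A:\mathbb{R}^d\to\mathcal{G}$ be a bounded linear operator into a real Hilbert space $\mathcal{G}$, let $g\in\mathcal{G}$, $\mu>0$, and suppose $0<\tau\le 1/\|A\|^2$. Let $f_0\in\mathbb{R}^d$ be such that $\sigma_0=\|Af_0-g\|>0$, let $\{(f_k,\sigma_k)\}_{k\ge 0}$ be defined by $$f_{k+1}=S_{2\tau\mu\sigma_k}\big(f_k+\tau A^*(g-Af_k)\big),\qquad \sigma_{k+1}=\|Af_{k+1}-g\|,\qquad k=0,1,\dots,$$ and let $f_*=\lim_k f_k$ (this limit exists). Suppose that there is a constant $\sigma_{\min}$ with $\sigma_k\ge\sigma_{\min}>0$ for all $k$. Then, for all $k\ge 1$, $$\Phi_\mu(f_k)-\Phi_\mu(f_* )\le\frac{\|f_0-f_*\|^2}{2\tau\sigma_{\min}k},$$ where $\Phi_\mu(f)=\|Af-g\|+\mu\|f\|_1$.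
   Context: $\mathbb{R}^d$ carries its Euclidean norm $\|\cdot\|$ and a fixed orthonormal basis $\{\varphi_\gamma\}_{\gamma\in\Gamma}$; for $f\in\mathbb{R}^d$, $f_\gamma=(f,\varphi_\gamma)$ and $\|f\|_1=\sum_{\gamma}|f_\gamma|$. $\|A\|$ is the operator (spectral) norm and $A^*$ the adjoint of $A$. For $t\ge 0$ the soft-thresholding function on $\mathbb{R}$ is $S_t(x)=x+t/2$ if $x\le -t/2$, $S_t(x)=0$ if $|x|<t/2$, $S_t(x)=x-t/2$ if $x\ge t/2$; it acts on vectors component-wise: $S_t(h)=\sum_\gamma S_t(h_\gamma)\varphi_\gamma$ where $h=\sum_\gamma h_\gamma\varphi_\gamma$. *)

(* Defs.v *)
From HB Require Import structures.
From mathcomp Require Import all_boot all_order all_algebra.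
From mathcomp Require Import all_classical all_reals all_analysis.
Set Implicit Arguments.
Unset Strict Implicit.
Unset Printing Implicit Defensive.
Import Order.TTheory GRing.Theory Num.Theory.
Import numFieldNormedType.Exports.
Local Open Scope classical_set_scope.
Local Open Scope ring_scope.

(* R^d is 'rV[R]_d.  The library norm on matrices is the sup norm, so the
   Euclidean structure is defined here; the topology is the same. *)
Definition dotv (R : realType) (d : nat) (u v : 'rV[R]_d) : R :=
  \sum_(i < d) u 0 i * v 0 i.

Definition enorm (R : realType) (d : nat) (u : 'rV[R]_d) : R :=
  Num.sqrt (dotv u u).

Definition orthonormal_basis (R : realType) (d : nat) (Gamma : finType)
    (phi : Gamma -> 'rV[R]_d) : Prop :=
  basis_of fullv (codom phi) /\
  (forall a b : Gamma, dotv (phi a) (phi b) = (a == b)%:R).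

Definition l1norm (R : realType) (d : nat) (Gamma : finType)
    (phi : Gamma -> 'rV[R]_d) (f : 'rV[R]_d) : R :=
  \sum_(c : Gamma) `|dotv f (phi c)|.

(* With completeness of G, this makes (G, ip) a real Hilbert space. *)
Definition norm_from_dot (R : realType) (G : normedModType R)
    (ip : {dot G for idfun}) : Prop :=
  forall x : G, `|x| = Num.sqrt (ip x x).

Definition bounded_operator (R : realType) (d : nat) (G : normedModType R)
    (A : 'rV[R]_d -> G) : Prop :=
  exists M : R, forall f : 'rV[R]_d, `|A f| <= M * enorm f.

Definition opnorm (R : realType) (d : nat) (G : normedModType R)
    (A : 'rV[R]_d -> G) : R :=
  sup [set `|A f| | f in [set f : 'rV[R]_d | enorm f <= 1]].

Definition is_adjoint (R : realType) (d : nat) (G : normedModType R)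
    (ip : {dot G for idfun}) (A : 'rV[R]_d -> G) (As : G -> 'rV[R]_d) : Prop :=
  forall (f : 'rV[R]_d) (y : G), ip (A f) y = dotv f (As y).

Definition soft (R : realType) (t x : R) : R :=
  if x <= - (t / 2) then x + t / 2
  else if `|x| < t / 2 then 0
  else x - t / 2.

Definition softv (R : realType) (d : nat) (Gamma : finType)
    (phi : Gamma -> 'rV[R]_d) (t : R) (h : 'rV[R]_d) : 'rV[R]_d :=
  \sum_(c : Gamma) soft t (dotv h (phi c)) *: phi c.

Definition Phi (R : realType) (d : nat) (Gamma : finType)
    (phi : Gamma -> 'rV[R]_d) (G : normedModType R)
    (A : 'rV[R]_d -> G) (g : G) (mu : R) (f : 'rV[R]_d) : R :=
  `|A f - g| + mu * l1norm phi f.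

(* Main.v *)
Require Import Defs.
From HB Require Import structures.
From mathcomp Require Import all_boot all_order all_algebra.
From mathcomp Require Import all_classical all_reals all_analysis.
From mathcomp Require Import ring lra.
Import Order.TTheory GRing.Theory Num.Theory.
Import numFieldNormedType.Exports.
Local Open Scope classical_set_scope.
Local Open Scope ring_scope.

(* Each step minimizes a quadratic majorant of the Lasso functional with weight
   [mu * sigma k]; combined with Cauchy-Schwarz in [G] and
   [2 a b <= a ^ 2 + b ^ 2], its optimality condition gives, for every [x],
     2 tau sigma_k (Phi (f k.+1) - Phi x) <= ||f k - x||^2 - ||f k.+1 - x||^2.
   With [x = f k] this makes [Phi (f k)] nonincreasing, so the iterates are
   bounded and have a cluster point [p] with [Phi p <= Phi (f k)].  With [x = p]
   it makes [||f k - p||] nonincreasing, so the whole sequence converges to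
   [p], and telescoping yields the rate. *)

(** * Euclidean inner product on row vectors, and its agreement with the sup-norm topology *)

Section Euclidean.
Context {R : realType} {d : nat}.
Implicit Types x y z : 'rV[R]_d.

Lemma dotvC x y : dotv x y = dotv y x.
Proof. by apply: eq_bigr => i _; rewrite mulrC. Qed.

Lemma dotvDl x y z : dotv (x + y) z = dotv x z + dotv y z.
Proof. by rewrite -big_split; apply: eq_bigr => i _; rewrite mxE mulrDl. Qed.

Lemma dotvZl a x y : dotv (a *: x) y = a * dotv x y.
Proof. by rewrite mulr_sumr; apply: eq_bigr => i _; rewrite mxE mulrA. Qed.

Lemma dotvNl x y : dotv (- x) y = - dotv x y.
Proof. by rewrite -scaleN1r dotvZl mulN1r. Qed.

Lemma dotvBl x y z : dotv (x - y) z = dotv x z - dotv y z.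
Proof. by rewrite dotvDl dotvNl. Qed.

Lemma dotvBr x y z : dotv x (y - z) = dotv x y - dotv x z.
Proof. by rewrite dotvC dotvBl !(dotvC x). Qed.

Lemma dotv_suml (I : finType) (F : I -> 'rV[R]_d) x :
  dotv (\sum_i F i) x = \sum_i dotv (F i) x.
Proof.
have dot0 : dotv 0 x = 0 by rewrite -(scale0r 0) dotvZl mul0r.
exact: (big_morph (fun y => dotv y x) (fun y z => dotvDl y z x) dot0).
Qed.

Lemma dotv_ge0 x : 0 <= dotv x x.
Proof. by apply: sumr_ge0 => i _; rewrite -expr2 sqr_ge0. Qed.

Lemma enorm_ge0 x : 0 <= enorm x.
Proof. exact: sqrtr_ge0. Qed.

Lemma sqr_enorm x : enorm x ^+ 2 = dotv x x.
Proof. by rewrite sqr_sqrtr // dotv_ge0. Qed.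

Lemma enormB x y : enorm (x - y) = enorm (y - x).
Proof. by rewrite /enorm -opprB dotvNl dotvC dotvNl opprK. Qed.

Lemma enormZ a x : enorm (a *: x) = `|a| * enorm x.
Proof.
by rewrite /enorm dotvZl dotvC dotvZl mulrA -expr2 sqrtrM ?sqr_ge0 // sqrtr_sqr.
Qed.

Lemma enorm_eq0 x : (enorm x == 0) = (x == 0).
Proof.
apply/eqP/eqP => [x0|->]; last by rewrite -(scale0r 0) enormZ normr0 mul0r.
apply/rowP => i; have /eqP := sqr_enorm x.
rewrite x0 expr0n eq_sym psumr_eq0 => [/allP/(_ i)|j _]; last first.
  by rewrite -expr2 sqr_ge0.
by rewrite mem_index_enum mxE => /(_ isT); rewrite mulf_eq0 orbb => /eqP.
Qed.

Lemma enorm0 : enorm (0 : 'rV[R]_d) = 0.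
Proof. by apply/eqP; rewrite enorm_eq0. Qed.

(** Expand the square of [y - x = (y - z) + (z - x)]. This turns an optimality condition into a
    telescoping difference of squared distances. *)
Lemma dotv_three_points x y z :
  2 * dotv (y - z) (z - x)
    = enorm (y - x) ^+ 2 - enorm (z - x) ^+ 2 - enorm (y - z) ^+ 2.
Proof.
rewrite !sqr_enorm !dotvBl !dotvBr (dotvC z y) (dotvC x y) (dotvC z x); ring.
Qed.

Lemma le_coord_enorm x i : `|x 0 i| <= enorm x.
Proof.
rewrite -sqrtr_sqr ler_wsqrtr // /dotv (bigD1 i) //= expr2 lerDl.
by apply: sumr_ge0 => j _; rewrite -expr2 sqr_ge0.
Qed.

Lemma enorm_le_coord x (e : R) :
  (forall i, `|x 0 i| <= e) -> enorm x ^+ 2 <= e ^+ 2 *+ d.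
Proof.
move=> xe; rewrite sqr_enorm.
have -> : e ^+ 2 *+ d = \sum_(i < d) e ^+ 2 by rewrite sumr_const card_ord.
apply: ler_sum => i _; rewrite -expr2 -real_normK ?num_real //.
by rewrite lerXn2r ?nnegrE // (le_trans _ (xe i)).
Qed.

Lemma near_enorm_lt x {e : R} : 0 < e -> \forall y \near x, enorm (x - y) < e.
Proof.
(* Dividing by [d.+1] covers [d = 0] and gives strictness: a sup-norm ball of radius [r] only yields
   [r ^ 2 * d], which is below [(r * d.+1) ^ 2]. *)
move=> e0; have [r r0 ->] : exists2 r : R, 0 < r & e = r * d.+1%:R.
  by exists (e / d.+1%:R); rewrite ?divr_gt0 ?divfK.
apply/nbhs_ballP; exists r => //= y [_ xy].
rewrite -(ltr_pXn2r (n := 2)) ?nnegrE ?enorm_ge0 ?mulr_ge0 ?ltW //.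
have /le_lt_trans -> // : enorm (x - y) ^+ 2 <= r ^+ 2 *+ d.
  by apply: enorm_le_coord => i; rewrite !mxE ltW //; exact: xy.
rewrite exprMn -[_ *+ d]mulr_natr ltr_pM2l ?exprn_gt0 // -natrX ltr_nat.
exact: leq_pmulr.
Qed.

Lemma enorm_cvg (u : nat -> 'rV[R]_d) x :
  (forall e : R, 0 < e -> \forall k \near \oo, enorm (x - u k) < e) ->
  u @ \oo --> x.
Proof.
move=> ux; apply/cvg_ballP => e e0.
apply: filterS (ux e e0) => k uke; split=> // i j.
rewrite !ord1 /ball /=; apply: le_lt_trans uke.
by have := le_coord_enorm (x - u k) j; rewrite !mxE.
Qed.

End Euclidean.

(** The residual [z - soft t z] is [- t / 2], [z] or [t / 2] on the three branches, in each case a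
    subgradient of [t / 2 * |.|] at [soft t z]. *)
Lemma soft_optimal (R : realType) (t z x : R) : 0 <= t ->
  t / 2 * (`|soft t z| - `|x|) <= (z - soft t z) * (soft t z - x).
Proof.
move=> t0; rewrite /soft; set s := t / 2.
have s0 : 0 <= s by rewrite divr_ge0.
have [xl xr] : - `|x| <= x /\ x <= `|x|.
  by split; [rewrite lerNl -normrN|]; exact: ler_norm.
case: ifPn => [zs|]; last rewrite -ltNge => zs.
  rewrite ler0_norm; last by lra.
  nra.
case: ifPn => [|]; first by rewrite ltr_norml normr0 => /andP[? ?]; nra.
rewrite -leNgt lter_normr => /orP[sz|sz].
  rewrite ger0_norm; last by lra.
  nra.
(* Here [s <= - z] contradicts the failed first test. *)
lra.
Qed.

(** * Expansions in the orthonormal basis and the l1 norm *)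

Section OrthonormalBasis.
Context {R : realType} {d : nat} {Gamma : finType} {phi : Gamma -> 'rV[R]_d}.
Hypothesis onb : orthonormal_basis phi.
Implicit Types x y h : 'rV[R]_d.

Lemma dotv_sum_basis (a : Gamma -> R) c : dotv (\sum_b a b *: phi b) (phi c) = a c.
Proof.
rewrite dotv_suml (bigD1 c) //= dotvZl onb.2 eqxx mulr1 big1 ?addr0 // => b bc.
by rewrite dotvZl onb.2 (negPf bc) mulr0.
Qed.

Lemma basis_expansion x : x = \sum_c dotv x (phi c) *: phi c.
Proof.
have xs : x \in <<codom_tuple phi>>%VS.
  by rewrite (span_basis onb.1) memvf.
(* Any coefficients will do: orthonormality identifies them as inner products afterwards. *)
have [a ->] : exists a : Gamma -> R, x = \sum_c a c *: phi c.
  exists (fun c => coord (codom_tuple phi) (enum_rank c) x).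
  rewrite {1}(coord_span xs) (reindex (@enum_rank Gamma)) /=; last first.
    by apply: onW_bij; exact: enum_rank_bij.
  apply: eq_bigr => c _; rewrite (nth_map c) -?cardE ?ltn_ord //.
  by rewrite nth_enum_rank.
by apply: eq_bigr => c _; rewrite dotv_sum_basis.
Qed.

Lemma parseval x y : dotv x y = \sum_c dotv x (phi c) * dotv y (phi c).
Proof.
rewrite [in LHS](basis_expansion x) dotv_suml.
by apply: eq_bigr => c _; rewrite dotvZl (dotvC (phi c)).
Qed.

Lemma abs_dotv_basis_le x c : `|dotv x (phi c)| <= enorm x.
Proof.
rewrite -sqrtr_sqr ler_wsqrtr // (parseval x x) (bigD1 c) //= expr2 lerDl.
by apply: sumr_ge0 => j _; rewrite -expr2 sqr_ge0.
Qed.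

Lemma l1norm_le x : l1norm phi x <= enorm x *+ #|Gamma|.
Proof. by rewrite -sumr_const; apply: ler_sum => c _; exact: abs_dotv_basis_le. Qed.

Lemma l1normD x y : l1norm phi (x + y) <= l1norm phi x + l1norm phi y.
Proof.
by rewrite -big_split; apply: ler_sum => c _; rewrite dotvDl ler_normD.
Qed.

(** The [phi c] are unit vectors, so their coordinates are at most 1 in absolute value. *)
Lemma le_coord_l1norm x i : `|x 0 i| <= l1norm phi x.
Proof.
rewrite {1}(basis_expansion x) summxE (le_trans (ler_norm_sum _ _ _)) //.
apply: ler_sum => c _; rewrite mxE normrM ler_piMr //.
by rewrite (le_trans (le_coord_enorm _ _)) // /enorm onb.2 eqxx sqrtr1.
Qed.

(** Orthonormal coordinates decouple the problem, so the scalar inequalities add up. *)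
Lemma softv_optimal (t : R) h x : 0 <= t ->
  t / 2 * (l1norm phi (softv phi t h) - l1norm phi x)
    <= dotv (h - softv phi t h) (softv phi t h - x).
Proof.
move=> t0; rewrite parseval -sumrB mulr_sumr; apply: ler_sum => c _.
by rewrite !dotvBl dotv_sum_basis; exact: soft_optimal.
Qed.

End OrthonormalBasis.

(** * The operator norm *)

Section BoundedOperator.
Context {R : realType} {d : nat} {G : normedModType R}.
Context {A : {linear 'rV[R]_d -> G}}.
Hypothesis bndA : bounded_operator A.

Lemma le_opnorm x : `|A x| <= opnorm A * enorm x.
Proof.
have [->|x0] := eqVneq x 0.
  by rewrite linear0 normr0 enorm0 mulr0.
have nx : 0 < enorm x by rewrite lt_neqAle enorm_ge0 eq_sym enorm_eq0 x0.
rewrite -ler_pdivrMr //; apply: ub_le_sup.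
  (* Boundedness of [A] provides the upper bound without which [sup] would be a mere default
     value. *)
  have [M AM] := bndA; exists `|M| => _ [y /= y1 <-].
  rewrite (le_trans (AM y)) // (le_trans (ler_wpM2r (enorm_ge0 y) (ler_norm M))) //.
  exact: ler_piMr.
exists ((enorm x)^-1 *: x); last by rewrite linearZ normrZ gtr0_norm ?invr_gt0 // mulrC.
by rewrite /= enormZ gtr0_norm ?invr_gt0 // mulVf // gt_eqF.
Qed.

End BoundedOperator.

(** * The inner product of [G] and Cauchy-Schwarz *)

Section InnerProduct.
Context {R : realType} {G : normedModType R} {ip : {dot G for idfun}}.
Hypothesis normG : norm_from_dot ip.
Implicit Types u v : G.

Lemma ipC u v : ip u v = ip v u.
Proof. by rewrite (hermC ip u v) expr0 mul1r. Qed.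

Lemma sqr_norm_ip u : `|u| ^+ 2 = ip u u.
Proof.
rewrite normG sqr_sqrtr //; have [->|u0] := eqVneq u 0.
  by rewrite linear0r.
by rewrite ltW // neq0_dnorm_gt0.
Qed.

Lemma sqr_normB u v : `|u - v| ^+ 2 = `|u| ^+ 2 + `|v| ^+ 2 - 2 * ip u v.
Proof.
rewrite !sqr_norm_ip linearBl !linearBr /= (ipC v u); ring.
Qed.

(** Compare the expansion of [|u + v| ^ 2] with the triangle inequality, which the normed module [G]
    already has. *)
Lemma ip_le_norm u v : ip u v <= `|u| * `|v|.
Proof.
have := sqr_normB u (- v); rewrite opprK normrN linearNr.
have := ler_normD u v; have := normr_ge0 (u + v).
nra.
Qed.

End InnerProduct.

Lemma le_eps_mul (R : realFieldType) (a b C : R) :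
  (forall e, 0 < e -> a <= b + C * e) -> a <= b.
Proof.
move=> H; apply/ler_addgt0Pr => e e0.
have C0 : 0 < `|C| + 1 by rewrite ltr_wpDl.
apply: (le_trans (H (e / (`|C| + 1)) (divr_gt0 e0 C0))).
rewrite lerD2l mulrA ler_pdivrMr // mulrC ler_pM2l //.
by rewrite (le_trans (ler_norm C)) // lerDl.
Qed.

(** * Properties of the functional and the one-step estimate *)

Section Iteration.
Context {R : realType} {d : nat} {Gamma : finType} {phi : Gamma -> 'rV[R]_d}.
Context {G : normedModType R} {ip : {dot G for idfun}}.
Context {A : {linear 'rV[R]_d -> G}} {As : G -> 'rV[R]_d} {g : G} {mu tau : R}.
Hypothesis onb : orthonormal_basis phi.
Hypothesis normG : norm_from_dot ip.
Hypothesis bndA : bounded_operator A.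
Hypothesis adjA : is_adjoint ip A As.
Hypothesis mu0 : 0 < mu.
Hypothesis tau0 : 0 < tau.
Hypothesis tauA : tau * opnorm A ^+ 2 <= 1.

Local Notation Phi := (Phi phi A g mu).

(** The step-size condition in the form that makes the quadratic surrogate a majorant. *)
Lemma tau_sqr_norm_le x : tau * `|A x| ^+ 2 <= enorm x ^+ 2.
Proof.
have Ax := le_opnorm bndA x.
have : `|A x| ^+ 2 <= (opnorm A * enorm x) ^+ 2.
  by rewrite lerXn2r ?nnegrE // (le_trans _ Ax).
rewrite exprMn -(ler_pM2l tau0) => /le_trans -> //.
by rewrite mulrA ler_piMl // sqr_ge0.
Qed.

(** A Lipschitz bound, used to pass from values at the iterates to the value at a cluster point. *)
Lemma Phi_le_add x y :
  Phi x <= Phi y + (opnorm A + mu *+ #|Gamma|) * enorm (x - y).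
Proof.
have Axy : `|A x - g| <= `|A y - g| + opnorm A * enorm (x - y).
  have -> : A x - g = (A y - g) + A (x - y).
    by rewrite linearB [RHS]addrC addrA subrK.
  by rewrite (le_trans (ler_normD _ _)) // lerD2l le_opnorm.
have lxy : mu * l1norm phi x <= mu * l1norm phi y + mu *+ #|Gamma| * enorm (x - y).
  rewrite mulrnAl -mulrnAr -mulrDr ler_pM2l //.
  rewrite -{1}(subrKC y x) (le_trans (l1normD _ _)) // lerD2l.
  exact: l1norm_le.
rewrite /Defs.Phi; lra.
Qed.

Lemma l1norm_le_Phi x : l1norm phi x <= Phi x / mu.
Proof. by rewrite ler_pdivlMr // mulrC lerDr. Qed.

Lemma thresholding_step x y p :
  p = softv phi (2 * tau * mu * `|A y - g|) (y + tau *: As (g - A y)) ->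
  2 * tau * `|A y - g| * (Phi p - Phi x) <= enorm (y - x) ^+ 2 - enorm (p - x) ^+ 2.
Proof.
set t := 2 * tau * mu * _; set h := y + _ => pE.
pose u := A y - g; pose v := A p - g; pose w := A x - g.
have t0 : 0 <= t by rewrite !mulr_ge0 // ltW.
have := softv_optimal onb t h x t0; rewrite -pE.
have -> : h - p = (y - p) + tau *: As (g - A y) by rewrite /h addrAC.
rewrite dotvDl dotvZl [dotv (As _) _]dotvC -adjA.
have -> : ip (A (p - x)) (g - A y) = ip w u - ip v u.
  have -> : A (p - x) = v - w by rewrite [LHS]linearB /u /v /w opprB addrA subrK.
  by rewrite -(opprB _ g) linearNr linearBl opprB.
have three := dotv_three_points x y p.
have wu := ip_le_norm normG w u.
have uv := sqr_normB normG u v; rewrite (ipC u) in uv.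
have uvA : u - v = A (y - p) by rewrite [RHS]linearB /u /v /w opprB addrA subrK.
have := tau_sqr_norm_le (y - p); rewrite -uvA.
have sq : 0 <= tau * (`|u| - `|v|) ^+ 2 by rewrite mulr_ge0 ?sqr_ge0 // ltW.
have {}wu : tau * ip w u <= tau * (`|w| * `|u|) by rewrite ler_pM2l.
rewrite /Defs.Phi -/u -/v -/w /t -/u => Auv opt.
(* After doubling [opt], the [ip v u] terms from the gradient and from [uv] cancel. What remains is
   bounded by [wu] and by [2 |u| |v| <= |u| ^ 2 + |v| ^ 2], which is [sq]. *)
nra.
Qed.

End Iteration.

(** Bolzano-Weierstrass by compactness of a box; the cluster point is described by arbitrarily late
    close terms, so no subsequence is extracted. *)
Lemma bounded_coord_cluster (R : realType) (d : nat) (u : nat -> 'rV[R]_d) (M : R) :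
  (forall k i, `|u k 0 i| <= M) ->
  exists p, forall e : R, 0 < e -> forall N, exists2 n, (N <= n)%N & enorm (p - u n) < e.
Proof.
move=> uM.
have cK : compact [set v : 'rV[R]_d | forall i, v ord0 i \in `[- M, M]].
  by apply: (@rV_compact _ _ (fun=> `[- M, M]%classic)) => _; exact: segment_compact.
have [|p [_ clp]] := cK (u @ \oo) _.
  by exists 0%N => // k _ i; rewrite in_itv /= -ler_norml; exact: uM.
exists p => e e0 N.
have FN : (u @ \oo) [set u n | n in [set n | (N <= n)%N]].
  by exists N => // n Nn; exists n.
have [_ [[n Nn <-] pn]] := clp _ _ FN (near_enorm_lt p e0).
by exists n.
Qed.

(* tau <= 1 / ||A||^2 is written tau * ||A||^2 <= 1, so that 1 / 0 reads as
   +oo when A = 0. *)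
Theorem proposition10 (R : realType) (d : nat)
    (Gamma : finType) (phi : Gamma -> 'rV[R]_d)
    (G : completeNormedModType R) (ip : {dot G for idfun})
    (A : {linear 'rV[R]_d -> G}) (As : G -> 'rV[R]_d)
    (g : G) (mu tau : R) (f0 : 'rV[R]_d)
    (f : nat -> 'rV[R]_d) (sigma : nat -> R) :
  orthonormal_basis phi ->
  norm_from_dot ip ->
  bounded_operator A ->
  is_adjoint ip A As ->
  0 < mu ->
  0 < tau -> tau * opnorm A ^+ 2 <= 1 ->
  f 0%N = f0 ->
  0 < sigma 0%N ->
  (forall k : nat, sigma k = `|A (f k) - g|) ->
  (forall k : nat, f k.+1 =
     softv phi (2 * tau * mu * sigma k) (f k + tau *: As (g - A (f k)))) ->
  cvgn f /\
  (forall sigma_min : R,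
     0 < sigma_min -> (forall k : nat, sigma_min <= sigma k) ->
     forall k : nat, (1 <= k)%N ->
       Phi phi A g mu (f k) - Phi phi A g mu (limn f)
       <= enorm (f0 - limn f) ^+ 2 / (2 * tau * sigma_min * k%:R)).
Proof.
move=> onb normG bndA adjA mu0 tau0 tauA fE0 _ sigmaE fE.
set F := Phi phi A g mu.
have sigma_ge0 k : 0 <= sigma k by rewrite sigmaE.
have step k x : 2 * tau * sigma k * (F (f k.+1) - F x)
    <= enorm (f k - x) ^+ 2 - enorm (f k.+1 - x) ^+ 2.
  rewrite sigmaE; apply: (thresholding_step onb normG bndA adjA mu0 tau0 tauA).
  by rewrite fE sigmaE.
have tau_sigma_ge0 k : 0 <= 2 * tau * sigma k by rewrite !mulr_ge0 // ltW.
have F_step k : F (f k.+1) <= F (f k).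
  have := step k (f k); rewrite subrr enorm0 expr0n sub0r => le.
  (* Convergence is claimed without a lower bound on [sigma], so a zero residual must be allowed;
     the estimate then forces [f k.+1 = f k]. *)
  have [s0|s0] := eqVneq (sigma k) 0.
    move: le; rewrite s0 mulr0 mul0r oppr_ge0 => le.
    have /eqP : enorm (f k.+1 - f k) ^+ 2 = 0 by apply/le_anti; rewrite le sqr_ge0.
    by rewrite sqrf_eq0 enorm_eq0 subr_eq0 => /eqP ->.
  have ts : 0 < 2 * tau * sigma k by rewrite !mulr_gt0 // lt_neqAle eq_sym s0 sigma_ge0.
  by rewrite -subr_le0 -(pmulr_rle0 _ ts) (le_trans le) // oppr_le0 sqr_ge0.
have F_mono m n : (m <= n)%N -> F (f n) <= F (f m).
  by move=> /subnK <-; elim: (n - m)%N => // j; apply: le_trans (F_step _).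
have [p clp] : exists p, forall e : R, 0 < e ->
    forall N, exists2 n, (N <= n)%N & enorm (p - f n) < e.
  apply: (@bounded_coord_cluster _ _ f (F (f 0%N) / mu)) => k i.
  apply: (le_trans (le_coord_l1norm onb (f k) i)).
  apply: (le_trans (l1norm_le_Phi (A := A) (g := g) mu0 (f k))).
  by rewrite ler_pM2r ?invr_gt0 // F_mono.
have F_p k : F p <= F (f k).
  apply: (@le_eps_mul _ _ _ `|opnorm A + mu *+ #|Gamma| |) => e e0.
  (* A late iterate [f n] near [p] has value at most [F (f k)], and the Lipschitz bound transfers
     this to [p] up to a multiple of [e]. *)
  have [n kn pn] := clp e e0 k.
  apply: (le_trans (Phi_le_add onb bndA mu0 p (f n))).
  apply: lerD; first exact: F_mono.
  by rewrite (le_trans (ler_wpM2r (enorm_ge0 _) (ler_norm _))) // ler_wpM2l // ltW.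
have dist_step k : enorm (f k.+1 - p) ^+ 2 <= enorm (f k - p) ^+ 2.
  rewrite -subr_ge0; apply: le_trans (step k p).
  by rewrite mulr_ge0 // subr_ge0.
have dist_mono m n : (m <= n)%N -> enorm (f n - p) ^+ 2 <= enorm (f m - p) ^+ 2.
  by move=> /subnK <-; elim: (n - m)%N => // j; apply: le_trans (dist_step _).
have fp : f @ \oo --> p.
  (* One iterate within [e] of [p] suffices, since distances to [p] never increase. *)
  apply: enorm_cvg => e e0; have [n _ pn] := clp e e0 0%N.
  exists n => // k nk; rewrite /= enormB (le_lt_trans _ pn) // (enormB p).
  by rewrite -(ler_pXn2r (n := 2)) ?nnegrE ?enorm_ge0 // dist_mono.
split; first by apply/cvg_ex; exists p.
rewrite (cvg_lim _ fp) // => s s0 s_le k k1.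
(* The induction keeps [n] times the latest gap instead of the sum of all gaps, and retains the
   remaining distance so that the terms telescope. *)
have sum_step n : 2 * tau * s * n%:R * (F (f n) - F p)
    <= enorm (f 0%N - p) ^+ 2 - enorm (f n - p) ^+ 2.
  elim: n => [|n IH]; first by rewrite mulr0 mul0r subrr.
  have Fn0 := F_p n; have Fn1 := F_p n.+1.
  have ts : 2 * tau * s <= 2 * tau * sigma n by rewrite ler_pM2l ?mulr_gt0.
  (* Replacing [sigma n] by the smaller [s] is legitimate because the gap is nonnegative, by
     [F_p]. *)
  have last : 2 * tau * s * (F (f n.+1) - F p)
      <= enorm (f n - p) ^+ 2 - enorm (f n.+1 - p) ^+ 2.
    by apply: le_trans (step n p); rewrite ler_wpM2r // subr_ge0.
  have prev : 2 * tau * s * n%:R * (F (f n.+1) - F p)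
      <= 2 * tau * s * n%:R * (F (f n) - F p).
    by rewrite ler_wpM2l ?lerD2r // !mulr_ge0 // ltW.
  rewrite -natr1; lra.
rewrite ler_pdivlMr ?mulr_gt0 ?ltr0n // mulrC (le_trans (sum_step k)) //.
by rewrite fE0 gerBl sqr_ge0.
Qed.
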